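(* Let $\mathcal{G}$ be a metric graph satisfying the standing hypotheses (i)–(vi) listed in the context. Let $\sigma>1$ and $s>\max\{2,\sigma/(\sigma-1)\}$, and fix $R\ge R_0=\max\{2j,1\}$. Suppose that $u\in\mathcal{D}(\mathcal{G})$ satisfies $[\mathcal{K}(u)](x)=0$ for every $x\in\mathcal{V}$, and let $\varphi:\mathcal{G}\to\mathbb{R}$, $\varphi(x)=\phi\big(\tilde d(x,x_0)/R\big)$, be the test function defined in the context. Then $$\mathcal{L}_{\Delta_{\mathcal{G}}u}(\varphi^s)=\int_{\mathcal{G}}u\,(\Delta_{\mathcal{V}}\varphi^s)\,d\mu_{\mathcal{V}}+\sum_{e\in\mathcal{E}_\varphi}\int_{a_e}^{b_e}u_e(x)(\varphi_e^s)''(x)\,dx .$$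
   Context: **Metric graph.** Let $(\mathcal{V},E,l)$ be a weighted graph: $\mathcal{V}$ a countable set of vertices, $E$ a countable set of edges, $l:E\to(0,+\infty]$, $l_e:=l(e)$ the length of $e$. The metric graph $\mathcal{G}$ over $(\mathcal{V},E,l)$ is the pair $(\mathcal{V},\mathcal{E})$ with $\mathcal{E}=\bigcup_{e\in E}\{e\}\times(0,l_e)$; its points are the vertices and the interior points of edges. Each edge $e$ has an initial vertex $i(e)$ and a final vertex $j(e)$; $e$ is identified with $I_e=(0,l_e)$, and $i(e),j(e)$ correspond to the endpoints $0,l_e$ of $\overline{I}_e=[0,l_e]$. Write $e\ni v$ if $v=i(e)$ or $v=j(e)$, and $y\sim x$ if the vertices $x,y$ are joined by an edge. (One writes $e\in\mathcal{E}$ for edges too.) For $x,y\in\mathcal{G}$, $d(x,y)$ is the infimum of the lengths of paths in $\mathcal{G}$ joining $x$ and $y$ (interior points may be added as vertices). $B_R(x_0)=\{x\in\mathcal{G}: d(x,x_0)<R\}$. **Functions, measures, Laplacians.** For $f:\mathcal{G}\to\mathbb{R}$, $f_e$ is its restriction to $\overline{I}_e$. $C(\mathcal{G})$ is the set of $f$ with every $f_e\in C([0,l_e])$ and a common value at each vertex from all incident edges. $\mu_{\mathcal{V}}:\mathcal{V}\to(0,\infty)$ is a vertex measure; $\int_{\mathcal{G}}f\,d\mu_{\mathcal{V}}=\sum_{x\in\mathcal{V}}\mu_{\mathcal{V}}(x)f(x)$ and $\int_{\mathcal{G}}f\,d\mu_{\mathcal{E}}=\sum_e\int_0^{l_e}f_e(x)\,dx$.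 $\omega:E\to(0,\infty)$ is a symmetric positive weight. For a vertex $x$, $\Delta_{\mathcal{V}}f(x)=\frac{1}{\mu_{\mathcal{V}}(x)}\sum_{y\sim x}\omega(x,y)(f(y)-f(x))$; for $x\in I_e$, $\Delta_{\mathcal{E}}f(x)=f_e''(x)$. $$\mathcal{D}(\mathcal{G})=\{f\in C(\mathcal{G}): f_e\in C^2(I_e)\cap C^1(\overline{I}_e),\ f_e''\in L^\infty(I_e)\ \forall e\}.$$ For $f\in\mathcal{D}(\mathcal{G})$ one sets $\mathcal{L}_{\Delta_{\mathcal{G}}f}(g)=\int_{\mathcal{G}}g(\Delta_{\mathcal{V}}f)\,d\mu_{\mathcal{V}}+\int_{\mathcal{G}}g(\Delta_{\mathcal{E}}f)\,d\mu_{\mathcal{E}}$. For a vertex $v\in e$, $\frac{df_e(v)}{dn}=f_e'(v)$ if $j(e)=v$ and $=-f_e'(v)$ if $i(e)=v$; $[\mathcal{K}(f)](x)=\sum_{e\ni x}\frac{df_e(x)}{dn}$. **Standing hypotheses.** (i) $\mathcal{G}$ is infinite, connected, locally finite. (ii) $l_e<+\infty$ and $i(e)\ne j(e)$ for all edges $e$. (iii) There are a vertex $x_0\in\mathcal{V}$ and a sequence $\{x_n\}\subset\mathcal{V}$ with $d(x_n,x_0)\to+\infty$. (iv) For every $R>0$ the ball $B_R(x_0)$ is finite, i.e. involves only finitely many vertices and edges. (v) There is $C>0$ with $\sum_{y\sim x}\omega(x,y)\le C\mu_{\mathcal{V}}(x)$ for every $x\in\mathcal{V}$. (vi) $j:=\sup_e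 l_e<\infty$ and $r:=\inf_e l_e>0$. **Modified distance.** On each edge, $x\mapsto d(x,x_0)$ is either $d(i(e),x_0)+x$, or $d(j(e),x_0)+l_e-x$, or there is an interior point $q_e$ such that it equals $d(i(e),x_0)+x$ on $[0,q_e]$ and $d(j(e),x_0)+l_e-x$ on $[q_e,l_e]$; $\mathcal{V}_0$ is the set of such points $q_e$. Fix a $C^3$ function $\eta:[0,1]\to[0,1]$ with $\eta(0)=0$, $\eta(1)=1$, $\eta'_+(0)=\eta'_-(1)=0$, $\eta''_+(0)=\eta''_-(1)=0$, $\eta'\ge0$ on $(0,1)$, and $|\eta'|,|\eta''|\le C$. Define $\tilde x_e:[0,l_e]\to[0,l_e]$ by $\tilde x_e(x)=l_e\eta(x/l_e)$ if $e\cap\mathcal{V}_0=\emptyset$, and if $e\cap\mathcal{V}_0=\{q_e\}$ by $\tilde x_e(x)=q_e\eta(2x/l_e)$ on $[0,l_e/2]$ and $\tilde x_e(x)=(l_e-q_e)\eta\big((2x-l_e)/l_e\big)+q_e$ on $[l_e/2,l_e]$. The modified distance is $\tilde d(\cdot,x_0):\mathcal{G}\to\mathbb{R}$ with $\tilde d_e(x,x_0)=d(\tilde x_e(x),x_0)$ on each edge. **Test function.** $\phi\in C^2([0,\infty))$ satisfies $\phi\equiv1$ on $[0,1]$, $\phi\equiv0$ on $[2,\infty)$, $\phi'\le0$, and $|\phi'|,|\phi''|\le C$ for some $C>0$. $\varphi(x)=\phi(\tilde d(x,x_0)/R)$. Set $\mathrm{supp}(\varphi)=\{x\in\mathcal{G}:\tilde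 d(x,x_0)<2R\}$; $\mathcal{E}_\varphi$ is the (finite) set of edges meeting it, and $[a_e,b_e]\subset[0,l_e]$, $a_e<b_e$, denotes the segment (closure of the intersection) in which $e$ meets $\mathrm{supp}(\varphi)$; if an edge meets it in two such segments, both are included in the sum. *)

(* Defs.v *)
From HB Require Import structures.
From mathcomp Require Import all_boot all_order all_algebra.
From mathcomp Require Import all_classical all_reals all_analysis.

Set Implicit Arguments.
Unset Strict Implicit.
Unset Printing Implicit Defensive.

Import Order.TTheory GRing.Theory Num.Theory.
Import numFieldNormedType.Exports.

Local Open Scope classical_set_scope.
Local Open Scope ring_scope.

Section calculus.
Context {R : realType}.
Implicit Types (A : set R) (f : R -> R).

(* Derivative relative to A: the usual derivative at interior points of A, a
   one-sided derivative at the endpoints when A is an interval.  Only the values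
   of f on A matter. *)
Definition quot_in A f (x : R) : set_system R :=
  (fun h : R => h^-1 *: (f (h + x) - f x)) @ within [set h | A (h + x)] 0^'.

Definition derivable_in A f (x : R) : Prop := cvg (quot_in A f x).

Definition derive_in A f (x : R) : R := lim (quot_in A f x).

Fixpoint Ck_on A (k : nat) f : Prop :=
  {within A, continuous f} /\
  if k is k'.+1 then
    (forall x, A x -> derivable_in A f x) /\ Ck_on A k' (derive_in A f)
  else True.

(* Sum of a signed family, as the Lebesgue integral for the counting measure. *)
Definition csum (T : choiceType) (F : T -> \bar R) : \bar R :=
  (\esum_(i in [set: T]) F^\+ i - \esum_(i in [set: T]) F^\- i)%E.

End calculus.

Record metric_graph (R : realType) := MetricGraph {
  vertex : countType ;
  edge : countType ;
  i_end : edge -> vertex ;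
  j_end : edge -> vertex ;
  len : edge -> \bar R ;
  len_gt0 : forall e, (0 < len e)%E }.

Section graph.
Context {R : realType} (G : metric_graph R).
Implicit Types (e : edge G) (v : vertex G).

Definition ipoint e : Type := {x : R | (0 < x) && (x%:E < len e)%E}.

Definition gpoint : Type := (vertex G + {e : edge G & ipoint e})%type.

Definition vtx v : gpoint := inl v.

Definition oedge e : set R := [set x | 0 < x /\ (x%:E < len e)%E].
Definition cedge e : set R := [set x | 0 <= x /\ (x%:E <= len e)%E].

(* The point of the closed edge e at coordinate x; coordinates x <= 0 give the
   initial vertex and coordinates x >= l_e the final one. *)
Definition pt e (x : R) : gpoint :=
  if (insub x : option (ipoint e)) is Some y then inr (existT ipoint e y)
  else inl (if x <= 0 then i_end e else j_end e).

Definition restr (f : gpoint -> R) e : R -> R := fun x => f (pt e x).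

Definition incident e v : Prop := i_end e = v \/ j_end e = v.
Definition joins e v w : Prop :=
  (i_end e = v /\ j_end e = w) \/ (i_end e = w /\ j_end e = v).
Definition adj v w : Prop := exists e, joins e v w.

(* A path is a list of moves (e, s, t), each going from coordinate s to
   coordinate t along the closed edge e. *)
Fixpoint is_path (x : gpoint) (p : seq (edge G * R * R)) (y : gpoint) : Prop :=
  if p is (e, s, t) :: p' then
    [/\ cedge e s, cedge e t, x = pt e s & is_path (pt e t) p' y]
  else x = y.

Definition path_len (p : seq (edge G * R * R)) : R :=
  \sum_(m <- p) `|m.2 - m.1.2|.

Definition dist (x y : gpoint) : R :=
  inf [set path_len p | p in [set p | is_path x p y]].

Definition ball_at (rho : R) (x : gpoint) : set gpoint :=
  [set y | dist y x < rho].

Definition lr e : R := fine (len e).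
Definition jmax : R := fine (ereal_sup (range (@len R G))).

(* omega is given on edges; omega(v, w) adds up the weights of the edges joining
   v and w (a single edge when the graph has no parallel edges). *)
Definition weight (omega : edge G -> R) v w : R :=
  \sum_(e \in [set e | joins e v w]) omega e.

Record standing (mu : vertex G -> R) (omega : edge G -> R) (x0 : vertex G) :
    Prop := Standing {
  st_infinite : infinite_set [set: vertex G] ;
  st_connected : forall x y : gpoint, exists p, is_path x p y ;
  st_locally_finite : forall v, finite_set [set e | incident e v] ;
  st_len_fin : forall e, (len e < +oo)%E ;
  st_noloop : forall e, i_end e <> j_end e ;
  st_unbounded : exists xn : nat -> vertex G,
    (fun n => dist (vtx (xn n)) (vtx x0)) @ \oo --> +oo ;
  st_finite_balls : forall rho : R, 0 < rho ->
    finite_set [set v | ball_at rho (vtx x0) (vtx v)] /\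
    finite_set [set e | exists2 x, cedge e x & ball_at rho (vtx x0) (pt e x)] ;
  st_weight : exists2 C : R, 0 < C & forall v,
    \sum_(w \in [set w | adj v w]) weight omega v w <= C * mu v ;
  st_len_sup : (ereal_sup (range (@len R G)) < +oo)%E ;
  st_len_inf : (0 < ereal_inf (range (@len R G)))%E }.

Definition intV (mu : vertex G -> R) (f : gpoint -> R) : \bar R :=
  csum (fun v => (mu v * f (vtx v))%:E).

Definition intE (f : gpoint -> R) : \bar R :=
  csum (fun e => \int[lebesgue_measure]_(x in cedge e) (restr f e x)%:E)%E.

(* The two Laplacians are extended by 0 to the points where they are undefined;
   intV (resp. intE) does not see interior points (resp. vertices). *)
Definition lapV (mu : vertex G -> R) (omega : edge G -> R) (f : gpoint -> R) :
    gpoint -> R := fun x =>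
  match x with
  | inl v => (mu v)^-1 * \sum_(w \in [set w | adj v w])
                           weight omega v w * (f (vtx w) - f (vtx v))
  | inr _ => 0
  end.

Definition lapE (f : gpoint -> R) : gpoint -> R := fun x =>
  match x with
  | inl _ => 0
  | inr (existT e y) => (restr f e)^`(2)%classic (sval y)
  end.

Definition lap_functional (mu : vertex G -> R) (omega : edge G -> R)
    (f g : gpoint -> R) : \bar R :=
  (intV mu (g \* lapV mu omega f)%R + intE (g \* lapE f)%R)%E.

(* Equality of the values at a vertex is automatic for functions on gpoint. *)
Definition continuous_graph (f : gpoint -> R) : Prop :=
  forall e, {within cedge e, continuous (restr f e)}.

Definition domain_graph (f : gpoint -> R) : Prop :=
  continuous_graph f /\
  forall e, [/\
    forall x, oedge e x ->
      derivable (restr f e) x 1 /\ derivable (restr f e)^`()%classic x 1,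
    {within oedge e, continuous (restr f e)^`(2)%classic},
    Ck_on (cedge e) 1 (restr f e) &
    ((restr f e)^`(2)%classic \_ (oedge e)) \in Lfun lebesgue_measure +oo%E].

Definition normal_deriv (f : gpoint -> R) e v : R :=
  if j_end e == v then derive_in (cedge e) (restr f e) (lr e)
  else - derive_in (cedge e) (restr f e) 0.

Definition kirchhoff (f : gpoint -> R) v : R :=
  \sum_(e \in [set e | incident e v]) normal_deriv f e v.

(* Interior points of e at which the distance to x0 stops growing with x and
   starts decreasing; there is at most one on each edge. *)
Definition cutpt (x0 : vertex G) e : set R := [set q |
  [/\ oedge e q,
    forall x, 0 <= x <= q ->
      dist (pt e x) (vtx x0) = dist (vtx (i_end e)) (vtx x0) + x &
    forall x, q <= x <= lr e ->
      dist (pt e x) (vtx x0) = dist (vtx (j_end e)) (vtx x0) + lr e - x]].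

Definition xtilde (eta : R -> R) (x0 : vertex G) e (x : R) : R :=
  if `[< exists q, cutpt x0 e q >] then
    let q := xget 0 (cutpt x0 e) in
    if x <= lr e / 2 then q * eta (2 * x / lr e)
    else (lr e - q) * eta ((2 * x - lr e) / lr e) + q
  else lr e * eta (x / lr e).

(* At a vertex no reparametrization is needed: xtilde fixes 0 and l_e. *)
Definition dtilde (eta : R -> R) (x0 : vertex G) : gpoint -> R := fun x =>
  match x with
  | inl v => dist (vtx v) (vtx x0)
  | inr (existT e y) => dist (pt e (xtilde eta x0 e (sval y))) (vtx x0)
  end.

Definition testfun (eta phi : R -> R) (x0 : vertex G) (rho : R) :
  gpoint -> R := fun x => phi (dtilde eta x0 x / rho).

Definition supp (eta : R -> R) (x0 : vertex G) (rho : R) : set gpoint :=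
  [set x | dtilde eta x0 x < 2 * rho].

Definition edges_supp (eta : R -> R) (x0 : vertex G) (rho : R) : set (edge G) :=
  [set e | exists2 x, cedge e x & supp eta x0 rho (pt e x)].

(* The segment [a_e, b_e] of e, or the union of the two segments when e meets the
   support in two of them. *)
Definition segment_supp (eta : R -> R) (x0 : vertex G) (rho : R) e : set R :=
  closure [set x | cedge e x /\ supp eta x0 rho (pt e x)].

End graph.

Section profiles.
Context {R : realType}.

Record is_eta (eta : R -> R) : Prop := IsEta {
  eta_range : forall x, 0 <= x <= 1 -> 0 <= eta x <= 1 ;
  eta_C3 : Ck_on `[0, 1] 3 eta ;
  eta_0 : eta 0 = 0 ;
  eta_1 : eta 1 = 1 ;
  eta_d0 : derive_in `[0, 1] eta 0 = 0 ;
  eta_d1 : derive_in `[0, 1] eta 1 = 0 ;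
  eta_dd0 : derive_in `[0, 1] (derive_in `[0, 1] eta) 0 = 0 ;
  eta_dd1 : derive_in `[0, 1] (derive_in `[0, 1] eta) 1 = 0 ;
  eta_d_ge0 : forall x, 0 < x < 1 -> 0 <= derive_in `[0, 1] eta x ;
  eta_bound : exists2 C : R, 0 < C & forall x, 0 <= x <= 1 ->
    `|derive_in `[0, 1] eta x| <= C /\
    `|derive_in `[0, 1] (derive_in `[0, 1] eta) x| <= C }.

Record is_phi (phi : R -> R) : Prop := IsPhi {
  phi_C2 : Ck_on `[0, +oo[ 2 phi ;
  phi_1 : forall x, 0 <= x <= 1 -> phi x = 1 ;
  phi_0 : forall x, 2 <= x -> phi x = 0 ;
  phi_d_le0 : forall x, 0 <= x -> derive_in `[0, +oo[ phi x <= 0 ;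
  phi_bound : exists2 C : R, 0 < C & forall x, 0 <= x ->
    `|derive_in `[0, +oo[ phi x| <= C /\
    `|derive_in `[0, +oo[ (derive_in `[0, +oo[ phi) x| <= C }.

End profiles.

(* Main.v *)
Require Import Defs.
From mathcomp Require Import all_boot all_order all_algebra.
From mathcomp Require Import all_classical all_reals all_analysis.
From mathcomp Require Import measurable_realfun ess_sup_inf ring lra.

Set Implicit Arguments.
Unset Strict Implicit.
Unset Printing Implicit Defensive.

Import Order.TTheory GRing.Theory Num.Theory.
Import numFieldNormedType.Exports.

Local Open Scope classical_set_scope.
Local Open Scope ring_scope.

(** The identity is two symmetric Green formulas, one for each Laplacian, whose
    boundary terms cancel.  Put p = phi(dtilde / rho)^s.  Since balls around x0
    are finite, p vanishes at all but finitely many vertices and on all but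
    finitely many edges, so every sum below is finite.

    On the vertices, mu cancels in mu(v) (Delta_V f)(v), and the double sums of
    weight(v, w) p(v) (u(w) - u(v)) and of weight(v, w) u(v) (p(w) - p(v)) are
    equal because the weight is symmetric ([lapV_symmetric]).

    On an edge, the point is that t |-> dtilde(t) is the restriction of a C^2
    function of the real line, constant outside [0, l_e]
    ([dtilde_profile]).  Indeed d(., x0) at coordinate t is the minimum of
    d(i(e), x0) + t and d(j(e), x0) + l_e - t ([dist_pt]), so it has at most one
    kink, and the reparametrization xtilde has vanishing first and second
    derivatives at the ends and at the parameter sent to that kink.  As
    phi >= 0 and s > 2, the power phi^s is C^2 as well ([C2_phi_power]).  So p is
    C^2 along each edge with zero slope at both ends, and integrating by parts
    twice leaves only the boundary term p(j(e)) u_e'(l_e) - p(i(e)) u_e'(0)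
    ([green_segment], [edge_green]).  As u_e'' is only bounded and continuous in
    the open edge, this rests on a form of the fundamental theorem of calculus
    for an integrable derivative that is continuous in the open interval
    ([FTC_interior]).

    Summed over the edges and regrouped by vertices, the boundary terms are
    the sum of p(v) K(u)(v), which is zero ([kirchhoff_boundary]).  Finally p'' = 0
    off the segments [a_e, b_e], because p vanishes in a neighborhood of each
    point outside them ([segment_integral]). *)

(** * Calculus on the line *)

Section ftc_interior.
Context {R : realType}.
Notation mu := (@lebesgue_measure R).

(** The primitive G of f is continuous on [a, b] because f is integrable, and
    G' = f = F' inside; so G - F is constant by the mean value theorem.  The
    form of the hypotheses allows for an f that is discontinuous at a and b, such
    as the second derivative of a function that is C^1 up to the ends. *)
Lemma FTC_interior (a b : R) (F f : R -> R) : a < b ->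
  {within `[a, b], continuous F} ->
  (forall x, a < x < b -> is_derive x 1 F (f x)) ->
  (forall x, a < x < b -> {for x, continuous f}) ->
  mu.-integrable `[a, b] (EFin \o f) ->
  (\int[mu]_(x in `[a, b]) (f x)%:E)%E = (F b - F a)%:E.
Proof.
move=> ab cF dF cf intf.
pose G x := \int[mu]_(t in [set` `[a, x]]) f t.
have cG : {within `[a, b], continuous G}.
  exact: (parameterized_integral_continuous (ltW ab) intf).
have dH x : x \in `]a, b[ -> is_derive x 1 (G \- F) ((cst 0 : R -> R) x).
  rewrite in_itv/= => axb; have /andP[ax xb] := axb.
  have [dG G'] := continuous_FTC1_closed xb intf ax (cf _ axb).
  have dGx : is_derive x 1 G (f x) by split; [exact: dG|rewrite -derive1E].
  have := @is_deriveB _ _ _ _ _ _ _ _ _ dGx (dF _ axb).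
  by rewrite subrr.
have cH : {within `[a, b], continuous (G \- F)}.
  by move=> x; apply: cvgB; [exact: cG|exact: cF].
have [c _] := MVT_segment (ltW ab) dH cH.
rewrite mul0r /= => /eqP; rewrite subr_eq0 => /eqP.
have -> : G a = 0 by rewrite /G set_itv1 Rintegral_set1.
move=> GF; have {}GF : G b = F b - F a by move: GF; lra.
rewrite -GF /G /Rintegral fineK//.
exact: integrable_fin_num.
Qed.

End ftc_interior.

Section C2.
Context {R : realType}.
Implicit Types f g : R -> R.

(** The first two derivatives are explicit parameters because the vanishing of
    the first one at the ends of an edge has to be tracked through sums and
    compositions. *)
Definition C2 f f1 f2 :=
  [/\ forall x : R, is_derive x 1 f (f1 x),
      forall x : R, is_derive x 1 f1 (f2 x) & continuous f2].

Lemma is_derive_continuous f f1 : (forall x : R, is_derive x 1 f (f1 x)) ->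
  continuous f.
Proof.
move=> df x; apply: differentiable_continuous; apply/derivable1_diffP.
by have [] := df x.
Qed.

Lemma C2_cst (c : R) : C2 (cst c) (cst 0) (cst 0).
Proof. by split=> x; try exact: is_derive_cst; exact: cst_continuous. Qed.

Lemma C2_affine (a b : R) : C2 (fun x => a * x + b) (cst a) (cst 0).
Proof.
split=> x; last exact: cst_continuous; last exact: is_derive_cst.
have -> : (fun x : R => a * x + b) = a \*: id + cst b by apply/funext.
by apply: is_derive_eq; rewrite addr0 /GRing.scale/= mulr1.
Qed.

Lemma C2D f f1 f2 g g1 g2 : C2 f f1 f2 -> C2 g g1 g2 ->
  C2 (f \+ g) (f1 \+ g1) (f2 \+ g2).
Proof.
case=> df df1 cf2 [dg dg1 cg2]; split=> x.
- exact: (is_deriveD (df x) (dg x)).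
- exact: (is_deriveD (df1 x) (dg1 x)).
- by apply: cvgD; [exact: cf2|exact: cg2].
Qed.

Lemma C2_comp f f1 f2 g g1 g2 : C2 f f1 f2 -> C2 g g1 g2 ->
  C2 (f \o g) (fun x => f1 (g x) * g1 x)
     (fun x => f2 (g x) * g1 x ^+ 2 + f1 (g x) * g2 x).
Proof.
case=> df df1 cf2 [dg dg1 cg2]; split=> x.
- have := @is_derive1_comp _ f g x _ _ (df (g x)) (dg x).
  by [].
- have h := @is_derive1_comp _ f1 g x _ _ (df1 (g x)) (dg x).
  have := is_deriveM h (dg1 x).
  move=> /is_derive_eq; apply.
  by rewrite /GRing.scale/= expr2; ring.
- have cf1 := is_derive_continuous df1.
  have cg := is_derive_continuous dg.
  have cg1 := is_derive_continuous dg1.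
  have c2 : {for x, continuous (f2 \o g)} by apply: continuous_comp; [exact: cg|exact: cf2].
  have c1 : {for x, continuous (f1 \o g)} by apply: continuous_comp; [exact: cg|exact: cf1].
  apply: cvgD; apply: cvgM => //; [|exact: cg2].
  by rewrite expr2; apply: cvgM; exact: cg1.
Qed.

End C2.

Section one_sided.
Context {R : realType}.
Implicit Types (f g : R -> R) (A : set R).

Lemma cvg_is_derive f (x l : R) :
  (fun h : R => h^-1 *: (f (h + x) - f x)) @ 0^' --> l -> is_derive x 1 f l.
Proof.
move=> fl.
have E : (fun h : R => h^-1 *: ((f \o shift x) (h *: 1) - f x)) =
         (fun h : R => h^-1 *: (f (h + x) - f x)).
  by apply/funext => h /=; rewrite /GRing.scale/= mulr1.
split; first by rewrite /derivable E; apply/cvg_ex; exists l.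
by rewrite /derive E; apply/cvg_lim.
Qed.

Lemma near_shift0 (x : R) (P : set R) :
  (\forall y \near x, P y) -> \forall h \near 0^', P (h + x).
Proof.
move=> Px; rewrite near_withinE.
have : \forall h \near (0:R), P (h + x).
  have : (h + x) @[h --> (0 : R)] --> x.
    by rewrite -[X in _ --> X]add0r; apply: cvgD; [exact: cvg_id|exact: cvg_cst].
  by move=> /(_ _ Px).
by apply: filterS.
Qed.

(** Here g is f continued by locally constant values outside A.  At a boundary
    point of A the two sides agree to first order exactly when the derivative of
    f relative to A vanishes there; elsewhere only one side is seen. *)
Lemma is_derive_patch A f g : closed A ->
  (forall x, A x -> g x = f x) ->
  (forall x, A x -> derivable_in A f x) ->
  (forall x, \forall y \near x, ~ A y -> g y = g x) ->
  (forall x, A x -> nbhs x A \/ derive_in A f x = 0) ->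
  forall x : R, is_derive x 1 g ((derive_in A f \_ A) x).
Proof.
move=> cA gf df gcst bd x; apply: cvg_is_derive.
rewrite patchE; case: ifPn => [/set_mem Ax|/negP nAx]; last first.
  have {}nAx : ~ A x by move=> Ax; apply: nAx; exact/mem_set.
  apply: (@cvg_trans _ ((cst 0 : R -> R) @ (0 : R)^')); last exact: cvg_cst.
  apply: near_eq_cvg.
  have nA : \forall y \near x, ~ A y by apply: open_nbhs_nbhs; split => //; exact: closed_openC.
  have nA' := near_shift0 nA; have gc := near_shift0 (gcst x).
  by near=> h; rewrite /= (near gc h)// ?subrr ?scaler0//; exact: (near nA' h).
have dAx := df x Ax.
have {dAx} : (fun h : R => h^-1 *: (f (h + x) - f x)) @
   within [set h | A (h + x)] 0^' --> derive_in A f x := dAx.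
move=> /cvgrPdist_le dAx.
apply/cvgrPdist_le => e e0; have /= := dAx e e0; rewrite near_withinE => {}dAx.
have gc := near_shift0 (gcst x).
have : \forall h \near 0^', A (h + x) \/ derive_in A f x = 0.
  case: (bd x Ax) => [/near_shift0|->]; last by near=> h; right.
  by apply: filterS => h; left.
move=> bd'; near=> h.
have [Ah|nAh] := pselect (A (h + x)).
  by rewrite !gf//; exact: (near dAx h).
have : A (h + x) \/ derive_in A f x = 0 by exact: (near bd' h).
move=> [//|->].
by rewrite (near gc h)// subrr scaler0 subrr normr0 ltW.
Unshelve. all: by end_near. Qed.

Lemma derive_in_is_derive A f (x : R) : nbhs x A -> derivable_in A f x ->
  is_derive x 1 f (derive_in A f x).
Proof.
move=> /near_shift0 nA dAx; apply: cvg_is_derive.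
have {dAx} : (fun h : R => h^-1 *: (f (h + x) - f x)) @
   within [set h | A (h + x)] 0^' --> derive_in A f x := dAx.
move=> /cvgrPdist_le dAx; apply/cvgrPdist_le => e e0.
have := dAx e e0; rewrite near_withinE => {}dAx.
by near=> h; apply: (near dAx h) => //; exact: (near nA h).
Unshelve. all: by end_near. Qed.

(** The points to the right of x already determine the derivative relative to A,
    whatever A looks like on the left; so this treats an interior point of the
    half-line where phi is locally constant and its end 0 alike. *)
Lemma derive_in_right_cst A f (x : R) : derivable_in A f x ->
  (\forall y \near x^'+, A y /\ f y = f x) -> derive_in A f x = 0.
Proof.
move=> dAx fc.
have {}dAx : (fun h : R => h^-1 *: (f (h + x) - f x)) @
   within [set h | A (h + x)] 0^' --> derive_in A f x := dAx.
have fc' : \forall h \near (0 : R)^'+, A (h + x) /\ f (h + x) = f x.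
  move: fc; rewrite (@nbhs_right0P R x).
  by apply: filterS => h; rewrite addrC.
have F0 : (fun h : R => h^-1 *: (f (h + x) - f x)) @ 0^'+ --> (0 : R).
  apply: (@cvg_trans _ ((cst 0 : R -> R) @ (0 : R)^'+)); last exact: cvg_cst.
  apply: near_eq_cvg; near=> h => /=.
  have [_ ->] : A (h + x) /\ f (h + x) = f x by exact: (near fc' h).
  by rewrite subrr scaler0.
apply: (cvg_unique (@Rhausdorff R) _ F0).
move: dAx => /cvgrPdist_le dAx; apply/cvgrPdist_le => e e0.
have := dAx e e0; rewrite !near_withinE => {}dAx.
move: fc'; rewrite near_withinE => fc'.
near=> h => h0.
have [Ah _] : A (h + x) /\ f (h + x) = f x by exact: (near fc' h).
by apply: (near dAx h) => //; rewrite gt_eqF.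
Unshelve. all: by end_near. Qed.

(** Applying [is_derive_patch] twice: the derivative of the continuation is the
    relative derivative continued by zero, which is again a continuation by
    locally constant values since it vanishes at the boundary. *)
Lemma C2_patch A f g : closed A -> Ck_on A 2 f ->
  (forall x, A x -> g x = f x) ->
  (forall x, \forall y \near x, ~ A y -> g y = g x) ->
  (forall x, A x -> nbhs x A \/
     (derive_in A f x = 0 /\ derive_in A (derive_in A f) x = 0)) ->
  C2 g (derive_in A f \_ A) (derive_in A (derive_in A f) \_ A).
Proof.
move=> cA [_ [df [_ [ddf [cddf _]]]]] gf gcst bd.
have pcst (k : R -> R) (x : R) : (A x -> nbhs x A \/ k x = 0) ->
    \forall y \near x, ~ A y -> (k \_ A) y = (k \_ A) x.
  move=> kbd; have [Ax|nAx] := pselect (A x).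
    case: (kbd Ax) => [nA|kx0].
      by near=> y => nAy; exfalso; apply: nAy; exact: (near nA y).
    by near=> y => nAy; rewrite !patchE memNset// mem_set// kx0.
  by near=> y => nAy; rewrite !patchE !memNset.
split.
- apply: is_derive_patch => // x Ax; case: (bd _ Ax) => [|[]]; [left|right] => //.
- apply: is_derive_patch => //.
  + by move=> x Ax; rewrite patchE mem_set.
  + move=> x; apply: (pcst (derive_in A f) x _) => Ax.
    by case: (bd _ Ax) => [|[]]; [left|right].
  + by move=> x Ax; case: (bd _ Ax) => [|[]]; [left|right].
- move=> x.
  set k := derive_in A (derive_in A f).
  have kc : \forall y \near x, ~ A y -> (k \_ A) y = (k \_ A) x.
    by apply: (pcst k x _) => Ax; case: (bd _ Ax) => [|[]]; [left|right].
  have [Ax|nAx] := pselect (A x); last first.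
    have nA : \forall y \near x, ~ A y by apply: open_nbhs_nbhs; split => //; exact: closed_openC.
    apply: (@cvg_trans _ ((cst ((k \_ A) x) : R -> R) @ nbhs x)); last exact: cvg_cst.
    by apply: near_eq_cvg; near=> y; rewrite /= (near kc y)//; exact: (near nA y).
  have /subspace_continuousP /(_ _ Ax) /cvgrPdist_le kx := cddf.
  apply/cvgrPdist_le => e e0; have := kx e e0; rewrite near_withinE => {}kx.
  near=> y; have [Ay|nAy] := pselect (A y).
    by rewrite !patchE !mem_set//; exact: (near kx y).
  by rewrite (near kc y)// subrr normr0 ltW.
Unshelve. all: by end_near. Qed.

End one_sided.

Section pospow.
Context {R : realType}.

(** The truncation at 0 makes the power differentiable at 0 from both sides:
    the power of a negative number is 1 by convention. *)
Definition pospow (p a : R) : R := (Num.max a 0) `^ p.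

Lemma pospow_le0 (p a : R) : p != 0 -> a <= 0 -> pospow p a = 0.
Proof. by move=> p0 a0; rewrite /pospow max_r// powR0. Qed.

Lemma near_pospow_gt0 (p a : R) : 0 < a ->
  \forall y \near a, y `^ p = pospow p y.
Proof.
move=> a0; near=> y; rewrite /pospow max_l// ltW//; near: y; exact: lt_nbhsr.
Unshelve. all: by end_near. Qed.

Lemma pospow_continuous (p : R) : 0 < p -> continuous (pospow p).
Proof.
move=> p0 a; have pN0 : p != 0 by rewrite gt_eqF.
have [a0|a0|->] := ltgtP a 0.
- apply: (@cvg_trans _ ((cst (pospow p a) : R -> R) @ nbhs a)); last exact: cvg_cst.
  apply: near_eq_cvg; near=> y => /=.
  rewrite !pospow_le0// ltW//; near: y; exact: lt_nbhsl.
- have c : {for a, continuous ((@powR R) ^~ p)}.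
    apply: differentiable_continuous; apply/derivable1_diffP.
    by have [] := @is_derive1_powR _ p a a0.
  rewrite /continuous_at.
  have -> : pospow p a = a `^ p by rewrite /pospow max_l// ltW.
  by apply: cvg_trans c; apply: near_eq_cvg; exact: near_pospow_gt0.
- rewrite /continuous_at pospow_le0//; apply/cvgrPdist_le => e e0; near=> y.
  rewrite sub0r normrN ger0_norm ?powR_ge0//.
  have ep : (e `^ p^-1) `^ p = e by rewrite -powRrM mulVf// powRr1// ltW.
  rewrite -[leRHS]ep ge0_ler_powR ?nnegrE ?powR_ge0 ?le_max ?lexx ?orbT ?(ltW p0)//.
  rewrite ge_max powR_ge0 andbT ltW//; near: y.
  by apply: lt_nbhsl; exact: powR_gt0.
Unshelve. all: by end_near. Qed.

(** At 0 the difference quotient of [pospow p] is [pospow (p - 1)], which tends to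
    0 because p > 1. *)
Lemma is_derive_pospow (p : R) : 1 < p ->
  forall a : R, is_derive a 1 (pospow p) (p * pospow (p - 1) a).
Proof.
move=> p1 a; have p0 : 0 < p by rewrite (lt_trans ltr01).
have pB0 : 0 < p - 1 by rewrite subr_gt0.
have pN0 : p != 0 by rewrite gt_eqF.
have pBN0 : p - 1 != 0 by rewrite gt_eqF.
have [a0|a0|->] := ltgtP a 0.
- rewrite pospow_le0 ?(ltW a0)// mulr0.
  apply: (near_eq_is_derive (f := (cst 0 : R -> R))).
  near=> y; rewrite /= pospow_le0// ltW//; near: y; exact: lt_nbhsl.
- have -> : pospow (p - 1) a = a `^ (p - 1) by rewrite /pospow max_l// ltW.
  exact: (near_eq_is_derive (near_pospow_gt0 p a0) (@is_derive1_powR _ p a a0)).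
- rewrite pospow_le0// mulr0; apply: cvg_is_derive.
  have : pospow (p - 1) @ 0^' --> (0 : R).
    have := (@pospow_continuous _ pB0 (0 : R)).
    rewrite /continuous_at pospow_le0//; apply: cvg_trans; apply: cvg_app.
    exact: cvg_within.
  apply: cvg_trans; apply: near_eq_cvg; rewrite near_withinE; near=> h => h0.
  rewrite addr0 (pospow_le0 pN0 (lexx 0)) subr0 /GRing.scale/=.
  have [hn|hp|h00] := ltgtP h 0; last by rewrite h00 eqxx in h0.
    by rewrite !pospow_le0 ?mulr0 ?(ltW hn).
  rewrite /pospow max_l ?(ltW hp)//.
  by rewrite -(mulr_powRB1 (ltW hp) p0) mulKf.
Unshelve. all: by end_near. Qed.

Lemma C2_pospow (p : R) : 2 < p ->
  C2 (pospow p) (fun a => p * pospow (p - 1) a)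
     (fun a => p * ((p - 1) * pospow (p - 1 - 1) a)).
Proof.
move=> p2; split.
- by apply: is_derive_pospow; lra.
- move=> a; have p1 : 1 < p - 1 by lra.
  by have := is_deriveZ p (is_derive_pospow p1 a).
- move=> a; apply: cvgM; first exact: cvg_cst.
  apply: cvgM; first exact: cvg_cst.
  by apply: pospow_continuous; lra.
Qed.

End pospow.

(** * Global extensions of the profiles *)

Section profiles_ext.
Context {R : realType}.

Definition clamp (l x : R) : R := Num.max 0 (Num.min x l).

Lemma clamp_id (l x : R) : 0 <= x <= l -> clamp l x = x.
Proof. by case/andP=> x0 xl; rewrite /clamp min_l// max_r. Qed.

Lemma clamp_le0 (l x : R) : 0 <= l -> x <= 0 -> clamp l x = 0.
Proof. by move=> l0 x0; rewrite /clamp min_l ?max_l// (le_trans x0). Qed.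

Lemma clamp_gel (l x : R) : 0 <= l -> l <= x -> clamp l x = l.
Proof. by move=> l0 lx; rewrite /clamp min_r// max_r. Qed.

Lemma clamp_itv (l x : R) : 0 <= l -> 0 <= clamp l x <= l.
Proof. by move=> l0; rewrite /clamp le_max lexx ge_max l0 ge_min lexx orbT. Qed.

Lemma clamp_continuous (l : R) : continuous (clamp l).
Proof.
move=> x; apply: (@continuous_max R R (cst 0) (fun y => Num.min y l)).
  exact: cvg_cst.
by apply: (@continuous_min R R id (cst l)); [exact: cvg_id|exact: cvg_cst].
Qed.

(** The first and second derivatives of eta vanish at 0 and 1, which is what
    makes its constant continuation C^2. *)
Lemma C2_eta_clamp (eta : R -> R) : is_eta eta ->
  exists e1 e2, C2 (eta \o clamp 1) e1 e2 /\
    (forall x, x <= 0 \/ 1 <= x -> e1 x = 0).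
Proof.
move=> He; set A : set R := [set` `[0, 1]].
have AE (x : R) : A x = (0 <= x <= 1) :> Prop by rewrite /A/= in_itv.
exists (derive_in A eta \_ A), (derive_in A (derive_in A eta) \_ A); split.
  apply: C2_patch.
  - exact: interval_closed.
  - by have [? [? [? [? [? _]]]]] := eta_C3 He.
  - by move=> x; rewrite AE => x01 /=; rewrite clamp_id.
  - move=> x; have [x0|x0] := leP x 0.
      near=> y => /=; rewrite AE => ny.
      have y1 : y < 1 by near: y; apply: lt_nbhsl; rewrite (le_lt_trans x0).
      rewrite !clamp_le0// leNgt; apply/negP => y0; apply: ny.
      by rewrite !ltW.
    have [x1|x1] := leP 1 x.
      near=> y => /=; rewrite AE => ny.
      have y0 : 0 < y by near: y; apply: lt_nbhsr.
      rewrite !clamp_gel// leNgt; apply/negP => y1; apply: ny.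
      by rewrite !ltW.
    near=> y => /=; rewrite AE => ny; exfalso; apply: ny.
    by apply/andP; split; apply: ltW; near: y; [exact: lt_nbhsr|exact: lt_nbhsl].
  - move=> x; rewrite AE => /andP[].
    rewrite le_eqVlt => /predU1P[<- _|x0].
      by right; split; [exact: eta_d0|exact: eta_dd0].
    rewrite le_eqVlt => /predU1P[->|x1].
      by right; split; [exact: eta_d1|exact: eta_dd1].
    left; near=> y; rewrite AE; apply/andP; split; apply: ltW; near: y.
      exact: lt_nbhsr.
    exact: lt_nbhsl.
move=> x x01; rewrite patchE; case: ifPn => // /set_mem; rewrite AE => /andP[x0 x1].
case: x01 => [xle|xge].
  by have -> : x = 0 by [apply/eqP; rewrite eq_le x0 xle]; exact: eta_d0.
by have -> : x = 1 by [apply/eqP; rewrite eq_le x1 xge]; exact: eta_d1.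
Unshelve. all: by end_near. Qed.

(** As phi = 1 on [0, 1], it continues by 1 to the negative half-line.  It is
    nonnegative because it decreases to the value 0 that it takes at 2. *)
Lemma C2_phi_max (phi : R -> R) : is_phi phi ->
  exists p1 p2, C2 (fun x => phi (Num.max x 0)) p1 p2 /\
    (forall x, 0 <= phi (Num.max x 0)).
Proof.
move=> Hp; set A : set R := [set` `[0, +oo[].
have AE (x : R) : A x = (0 <= x) :> Prop by rewrite /A/= in_itv /= andbT.
pose g (x : R) := phi (Num.max x 0).
have [_ [dphi [_ [ddphi _]]]] := phi_C2 Hp; rewrite -/A in dphi ddphi.
have d0 (x : R) : 0 <= x < 1 -> derive_in A phi x = 0.
  move=> /andP[x0 x1]; apply: derive_in_right_cst; first by apply: dphi; rewrite -/A AE.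
  near=> y; have xy : x < y by near: y; exact: nbhs_right_gt.
  have y1 : y < 1 by near: y; exact: nbhs_right_lt.
  split; first by rewrite AE (le_trans x0)// ltW.
  by rewrite !phi_1// ?x0 ?(ltW x1)// (ltW y1) andbT (le_trans x0)// ltW.
have C : C2 g (derive_in A phi \_ A) (derive_in A (derive_in A phi) \_ A).
  apply: C2_patch; first exact: interval_closed.
  - exact: phi_C2.
  - by move=> x; rewrite AE => x0; rewrite /g max_l.
  - move=> x; have [x0|x0] := leP x 0.
      near=> y; rewrite AE => ny.
      by rewrite /g !max_r// leNgt; apply/negP => y0; apply: ny; exact: ltW.
    near=> y; rewrite AE => ny; exfalso; apply: ny.
    by rewrite ltW//; near: y; exact: lt_nbhsr.
  - move=> x; rewrite AE le_eqVlt => /predU1P[<-|x0].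
      right; split; first by rewrite d0// lexx ltr01.
      apply: derive_in_right_cst; first by apply: ddphi; rewrite -/A AE.
      near=> y; have y0 : 0 < y by near: y; exact: nbhs_right_gt.
      have y1 : y < 1 by near: y; exact: nbhs_right_lt.
      by rewrite AE (ltW y0) !d0 ?lexx ?ltr01 ?(ltW y0).
    left; near=> y; rewrite AE ltW//; near: y; exact: lt_nbhsr.
exists (derive_in A phi \_ A), (derive_in A (derive_in A phi) \_ A); split=> //.
move=> x; have [x2|x2] := leP 2 x.
  by rewrite phi_0// le_max x2.
have [dg _ _] := C.
have g2 : g 2 = 0 by rewrite /g phi_0// le_max lexx.
rewrite -[leLHS]g2 -/(g x).
apply: (@ler0_derive1_nincr _ g x 2) => //; last exact: ltW.
- move=> y _; rewrite derive1E; have [_ ->] := dg y.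
  by rewrite patchE; case: ifPn => // /set_mem; rewrite AE => y0; exact: phi_d_le0.
- by apply: continuous_subspaceT => y; exact: is_derive_continuous dg y.
Unshelve. all: by end_near. Qed.

(** The bound s > 2 is needed where phi vanishes: there the second derivative of
    phi^s involves phi^(s - 2). *)
Lemma C2_phi_power (phi : R -> R) (s : R) : is_phi phi -> 2 < s ->
  exists th th1 th2,
    C2 th th1 th2 /\ forall x, 0 <= x -> phi x `^ s = th x.
Proof.
move=> Hp s2; have [p1 [p2 [Cp p0]]] := C2_phi_max Hp.
do 3!eexists; split; first exact: (C2_comp (C2_pospow s2) Cp).
by move=> x x0 /=; rewrite /pospow (max_l (p0 _)) max_l.
Qed.

End profiles_ext.

(** * Distance along an edge *)

Section edges.
Context {R : realType} {G : metric_graph R}.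
Context {mu : vertex G -> R} {omega : edge G -> R} {x0 : vertex G}.
Hypothesis HG : standing mu omega x0.
Implicit Types (e : edge G) (x y z : gpoint G).

Lemma lenE e : len e = (lr e)%:E.
Proof.
by rewrite /lr fineK// ge0_fin_numE ?ltW ?len_gt0//; exact: st_len_fin HG e.
Qed.

Lemma lr_gt0 e : 0 < lr e.
Proof. by rewrite -lte_fin -lenE len_gt0. Qed.

Lemma cedgeE e : cedge e = [set` `[0, lr e]].
Proof.
apply/seteqP; split=> t; rewrite /cedge/= lenE lee_fin in_itv/=.
  by case=> -> ->.
by case/andP.
Qed.

Lemma oedgeE e : oedge e = [set` `]0, lr e[].
Proof.
apply/seteqP; split=> t; rewrite /oedge/= lenE lte_fin in_itv/=.
  by case=> -> ->.
by case/andP.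
Qed.

Lemma cedgeP e t : cedge e t <-> 0 <= t <= lr e.
Proof. by rewrite cedgeE /= in_itv. Qed.

Lemma pt_le0 e (t : R) : t <= 0 -> pt e t = vtx (i_end e).
Proof.
move=> t0; rewrite /pt insubN; first by rewrite t0.
by rewrite negb_and -leNgt t0.
Qed.

Lemma pt_gel e (t : R) : lr e <= t -> pt e t = vtx (j_end e).
Proof.
move=> lt; rewrite /pt insubN.
  by rewrite leNgt (lt_le_trans (lr_gt0 e) lt).
by rewrite negb_and lenE lte_fin -(leNgt _ t) lt orbT.
Qed.

Lemma pt_in e (t : R) : 0 < t < lr e ->
  exists2 y : ipoint e, pt e t = inr (existT _ e y) & sval y = t.
Proof.
move=> tl; have tl' : (0 < t) && (t%:E < len e)%E by rewrite lenE lte_fin.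
by exists (Sub t tl') => //; rewrite /pt insubT.
Qed.

Lemma pt_clamp e (t : R) : pt e (clamp (lr e) t) = pt e t.
Proof.
have l0 := ltW (lr_gt0 e).
have [t0|t0] := leP t 0; first by rewrite clamp_le0// !pt_le0.
have [tl|tl] := leP (lr e) t; first by rewrite clamp_gel// !pt_gel.
by rewrite clamp_id// !ltW.
Qed.

Lemma pt_inj e e' (s t : R) : 0 < s < lr e -> pt e s = pt e' t ->
  e' = e /\ t = s.
Proof.
move=> sl; have [y -> ys] := pt_in sl; rewrite /pt.
case: insubP => [y' _ y't|_]; last by [].
move=> eqs; pose coord (z : gpoint G) : edge G * R :=
  match z with inl _ => (e, 0) | inr (existT f u) => (f, sval u) end.
have : coord (inr (existT _ e y)) = coord (inr (existT _ e' y')) by rewrite eqs.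
by rewrite /= ys; move: y't => /= -> [-> ->].
Qed.

Lemma path_len_cons (m : edge G * R * R) p :
  path_len (m :: p) = `|m.2 - m.1.2| + path_len p.
Proof. by rewrite /path_len big_cons. Qed.

Lemma path_len_ge0 (p : seq (edge G * R * R)) : 0 <= path_len p.
Proof. by rewrite /path_len sumr_ge0. Qed.

Lemma dist_le x y p : is_path x p y -> dist x y <= path_len p.
Proof.
move=> xpy; apply: ge_inf; last by exists p.
by exists 0 => _ [p' _ <-]; exact: path_len_ge0.
Qed.

Lemma le_dist x y (m : R) : (forall p, is_path x p y -> m <= path_len p) ->
  m <= dist x y.
Proof.
move=> mp; apply: lb_le_inf; last by move=> _ [p xpy <-]; exact: mp.
by have [p xpy] := st_connected HG x y; exists (path_len p), p.
Qed.

Lemma dist_ge0 x y : 0 <= dist x y.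
Proof. by apply: le_dist => p _; exact: path_len_ge0. Qed.

Lemma dist_move e (s t : R) y : 0 <= s <= lr e -> 0 <= t <= lr e ->
  dist (pt e s) y <= `|t - s| + dist (pt e t) y.
Proof.
move=> /cedgeP se /cedgeP te; rewrite -lerBlDl; apply: le_dist => p pty.
rewrite lerBlDl -(path_len_cons (e, s, t)); apply: dist_le.
by split.
Qed.

Local Notation d v := (dist (vtx v) (vtx x0)).

Lemma dist_ends e : `|d (i_end e) - d (j_end e)| <= lr e.
Proof.
have l0 := ltW (lr_gt0 e).
have h0 : 0 <= (0 : R) <= lr e by rewrite lexx.
have hl : 0 <= lr e <= lr e by rewrite lexx l0.
have := dist_move (vtx x0) h0 hl; have := dist_move (vtx x0) hl h0.
rewrite subr0 sub0r normrN ger0_norm// (pt_le0 _ (lexx 0)) (pt_gel (lexx _)).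
by move=> h1 h2; rewrite ler_norml; apply/andP; split; lra.
Qed.

(** For the lower bound, follow a path to x0 move by move.  As long as it stands at
    an interior point of e the next move stays on e, and the right-hand side is
    1-Lipschitz along that move; once it stands at an end of e, its
    remaining length is at least the distance from that end. *)
Lemma dist_pt e (t : R) : 0 <= t <= lr e ->
  dist (pt e t) (vtx x0) = Num.min (d (i_end e) + t) (d (j_end e) + lr e - t).
Proof.
move=> tl; have l0 := ltW (lr_gt0 e).
have h0 : 0 <= (0 : R) <= lr e by rewrite lexx.
have hl : 0 <= lr e <= lr e by rewrite lexx l0.
apply/eqP; rewrite eq_le; apply/andP; split.
  rewrite le_min; have /andP[t0 tl'] := tl; apply/andP; split.
    have := dist_move (vtx x0) tl h0.
    by rewrite (pt_le0 _ (lexx 0)) sub0r normrN ger0_norm// addrC.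
  have := dist_move (vtx x0) tl hl.
  by rewrite (pt_gel (lexx _)) ger0_norm ?subr_ge0// addrC addrA.
apply: le_dist => p; elim: p t tl => [|[[e' s] s'] p IH] t tl ptx.
  rewrite /path_len big_nil.
  have dx : dist (vtx x0) (vtx x0) <= 0.
    have := @dist_le (vtx x0) (vtx x0) [::] erefl.
    by rewrite /path_len big_nil.
  rewrite ge_min; have [t0|t0] := leP t 0.
    move: ptx; rewrite /= pt_le0// => ->; apply/orP; left; lra.
  have [lt|lt] := leP (lr e) t.
    move: ptx; rewrite /= pt_gel// => ->; apply/orP; right; lra.
  have tl'' : 0 < t < lr e by rewrite t0 lt.
  by have [y] := pt_in tl''; move: ptx => /= ->.
have [t0|t0] := leP t 0.
  rewrite ge_min; apply/orP; left; have tE : t = 0 by lra.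
  by rewrite tE addr0; apply: dist_le; rewrite -(pt_le0 e t0).
have [lt|lt] := leP (lr e) t.
  rewrite ge_min; apply/orP; right; have tE : t = lr e by lra.
  by rewrite tE addrK; apply: dist_le; rewrite -(pt_gel lt).
move: ptx => /= [_ s'e ptE p'].
have tl'' : 0 < t < lr e by rewrite t0 lt.
have [ee' st] := pt_inj tl'' ptE; subst e' s.
have /cedgeP s'l := s'e.
have := IH _ s'l p'; rewrite path_len_cons /=.
have := ler_norm (s' - t); have := ler_norm (- (s' - t)); rewrite normrN.
by rewrite !ge_min => h1 h2 /orP[h|h]; apply/orP; [left|right]; lra.
Qed.

End edges.

(** * The modified distance along an edge *)

Section profile.
Context {R : realType} {G : metric_graph R}.
Context {mu : vertex G -> R} {omega : edge G -> R} {x0 : vertex G}.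
Hypothesis HG : standing mu omega x0.
Context {eta : R -> R}.
Hypothesis He : is_eta eta.
Implicit Types (e : edge G).

Local Notation d v := (dist (vtx v) (vtx x0)).

(** The coordinate at which the routes to x0 through the two ends of e have equal
    length.  It is an interior point of e exactly when e has a cut point. *)
Definition turn e : R := (d (j_end e) + lr e - d (i_end e)) / 2.

Lemma turn_itv e : 0 <= turn e <= lr e.
Proof.
have := dist_ends HG e; rewrite ler_norml /turn => /andP[h1 h2].
by apply/andP; split; lra.
Qed.

Lemma dist_pt_le_turn e (t : R) : 0 <= t <= turn e ->
  dist (pt e t) (vtx x0) = d (i_end e) + t.
Proof.
move=> /andP[t0 tq]; have /andP[_ ql] := turn_itv e.
rewrite (dist_pt HG) ?t0 ?(le_trans tq)// min_l//.
by move: tq; rewrite /turn; lra.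
Qed.

Lemma dist_pt_ge_turn e (t : R) : turn e <= t <= lr e ->
  dist (pt e t) (vtx x0) = d (j_end e) + lr e - t.
Proof.
move=> /andP[tq tl]; have /andP[q0 _] := turn_itv e.
rewrite (dist_pt HG) ?tl ?(le_trans q0 tq)// min_r//.
by move: tq; rewrite /turn; lra.
Qed.

Lemma cutptE e : cutpt x0 e = [set q | q = turn e /\ 0 < q < lr e].
Proof.
apply/seteqP; split=> q /=.
  move=> [[/= q0]]; rewrite (lenE HG) lte_fin => ql hi hj.
  split; last by rewrite q0 ql.
  have := hi q; rewrite lexx (ltW q0) => /(_ isT) h1.
  have := hj q; rewrite lexx (ltW ql) => /(_ isT) h2.
  by rewrite /turn; lra.
case=> -> /andP[q0 ql]; split.
- by rewrite /oedge/= (lenE HG) lte_fin.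
- by move=> t; exact: dist_pt_le_turn.
- by move=> t; exact: dist_pt_ge_turn.
Qed.

(** When the turning point q is interior, with E the constant continuation of eta,
    w(t) = d(i(e)) + q E(2 t / l) - (l - q) E(2 t / l - 1): on each half of the
    edge one of the two terms in E is constant, which yields both branches of
    xtilde in a single formula.  Otherwise q is 0 or l, the distance is affine on e,
    and one term suffices. *)
Lemma dtilde_profile e : exists w w1 w2 : R -> R,
  [/\ C2 w w1 w2, forall t, dtilde eta x0 (pt e t) = w t,
      w1 0 = 0 & w1 (lr e) = 0].
Proof.
have l0 := lr_gt0 HG e; have lN0 : lr e != 0 by rewrite gt_eqF.
have [E [e1 [e2 [[Ce e10] [E0 E1 Eid E01]]]]] : exists E e1 e2 : R -> R,
    (C2 E e1 e2 /\ forall t, t <= 0 \/ 1 <= t -> e1 t = 0) /\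
    [/\ forall t, t <= 0 -> E t = 0, forall t, 1 <= t -> E t = 1,
      forall t, 0 <= t <= 1 -> E t = eta t & forall t, 0 <= E t <= 1].
  have [e1 [e2 Ce]] := C2_eta_clamp He.
  exists (eta \o clamp 1), e1, e2; split=> //; split=> t.
  - by move=> t0; rewrite /= clamp_le0// eta_0.
  - by move=> t1; rewrite /= clamp_gel// eta_1.
  - by move=> t1; rewrite /= clamp_id.
  - by apply: (eta_range He); exact: clamp_itv.
have dti t : t <= 0 -> dtilde eta x0 (pt e t) = d (i_end e).
  by move=> t0; rewrite pt_le0.
have dtj t : lr e <= t -> dtilde eta x0 (pt e t) = d (j_end e).
  by move=> t0; rewrite (pt_gel HG).
have dto t : 0 < t < lr e ->
    dtilde eta x0 (pt e t) = dist (pt e (xtilde eta x0 e t)) (vtx x0).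
  by move=> tl; have [y -> /= ->] := pt_in HG tl.
have /andP[q0 ql] := turn_itv e.
have qE : d (i_end e) + turn e = d (j_end e) + lr e - turn e by rewrite /turn; lra.
have aff a b := C2_comp Ce (C2_affine a b).
have [cut|ncut] := pselect (0 < turn e < lr e).
  (* The distance increases up to the turning point and decreases after it. *)
  have xq : xget 0 (cutpt x0 e) = turn e.
    have : cutpt x0 e (xget 0 (cutpt x0 e)).
      by apply: xgetPex; exists (turn e); rewrite cutptE.
    by rewrite [X in X _ -> _]cutptE => -[].
  have hascut : `[< exists q, cutpt x0 e q >].
    by apply/asboolP; exists (turn e); rewrite cutptE.
  have C := C2D (C2_cst (d (i_end e))) (C2D
    (C2_comp (C2_affine (turn e) 0) (aff (2 / lr e) 0))
    (C2_comp (C2_affine (- (lr e - turn e)) 0) (aff (2 / lr e) (- 1)))).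
  do 3!eexists; split; first exact: C.
  - move=> t; rewrite /= !addr0.
    have -> : 2 / lr e * t = 2 * t / lr e by rewrite mulrAC.
    have tl1 : 2 * t / lr e + - 1 = (2 * t - lr e) / lr e by field.
    have [t0|t0] := leP t 0.
      have h : 2 * t / lr e <= 0 by rewrite pmulr_lle0 ?invr_gt0//; lra.
      by rewrite dti// !E0 ?mulr0 ?addr0//; lra.
    have [tl|tl] := leP (lr e) t.
      have h : 2 <= 2 * t / lr e by rewrite ler_pdivlMr//; lra.
      have h1 : E (2 * t / lr e) = 1 by apply: E1; lra.
      have h2 : E (2 * t / lr e + - 1) = 1 by apply: E1; lra.
      by rewrite dtj// h1 h2 !mulr1; lra.
    rewrite dto ?t0// /xtilde hascut xq.
    case: ifPn => [t2|]; last rewrite -ltNge => t2.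
      have t01 : 0 <= 2 * t / lr e <= 1.
        by apply/andP; split; [apply: divr_ge0|rewrite ler_pdivrMr//]; lra.
      rewrite -Eid// (E0 (_ + - 1)); last by rewrite subr_le0; case/andP: t01.
      have /andP[Eg0 El1] := E01 (2 * t / lr e).
      rewrite mulr0 addr0 dist_pt_le_turn// mulr_ge0//.
      by rewrite ler_piMr.
    have t01 : 0 <= (2 * t - lr e) / lr e <= 1.
      by apply/andP; split; [apply: divr_ge0|rewrite ler_pdivrMr//]; lra.
    rewrite -Eid// (E1 (2 * t / lr e)); last first.
      by rewrite ler_pdivlMr//; lra.
    rewrite tl1; have /andP[Eg0 El1] := E01 ((2 * t - lr e) / lr e).
    have lq0 : 0 <= lr e - turn e by rewrite subr_ge0.
    have h1 := mulr_ge0 lq0 Eg0.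
    have h2 : (lr e - turn e) * E ((2 * t - lr e) / lr e) <= lr e - turn e.
      by rewrite ler_piMr.
    rewrite dist_pt_ge_turn; last by apply/andP; split; lra.
    by rewrite mulr1; lra.
  - by rewrite /= mulr0 !e10 ?mul0r ?mulr0 ?addr0//; left; lra.
  - rewrite /= divfK// !e10 ?mul0r ?mulr0 ?addr0//; right; lra.
have xt t : xtilde eta x0 e t = lr e * eta (t / lr e).
  rewrite /xtilde; case: ifPn => // /asboolP[q]; rewrite cutptE => -[-> ].
  by move/ncut.
have tlE t : 0 < t < lr e -> eta (t / lr e) = E ((lr e)^-1 * t + 0).
  move=> /andP[t0 tl]; rewrite addr0 [_^-1 * t]mulrC Eid//.
  by apply/andP; split; [apply: divr_ge0|rewrite ler_pdivrMr//]; lra.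
have xt_itv t : 0 <= lr e * E t <= lr e.
  have /andP[Eg0 El1] := E01 t.
  by rewrite mulr_ge0 ?(ltW l0)//= ler_piMr// ltW.
have El t : lr e <= t -> E ((lr e)^-1 * t + 0) = 1.
  by move=> tl; apply: E1; rewrite addr0 mulrC ler_pdivlMr// mul1r.
have E0' t : t <= 0 -> E ((lr e)^-1 * t + 0) = 0.
  by move=> tl; apply: E0; rewrite addr0 pmulr_rle0// invr_gt0.
have [qL|qL] := eqVneq (turn e) (lr e).
  (* The shortest route always leaves through the initial vertex. *)
  have C := C2D (C2_cst (d (i_end e)))
    (C2_comp (C2_affine (lr e) 0) (aff ((lr e)^-1) 0)).
  do 3!eexists; split; first exact: C.
  - move=> t; rewrite /= [lr e * _ + 0]addr0.
    have [t0|t0] := leP t 0; first by rewrite dti// E0'// mulr0 addr0.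
    have [tl|tl] := leP (lr e) t; first by rewrite dtj// El// mulr1; lra.
    by rewrite dto ?t0// xt tlE ?t0// dist_pt_le_turn// qL.
  - by rewrite /= mulr0 !e10 ?mul0r ?mulr0 ?addr0//; left; lra.
  - rewrite /= mulVf// !e10 ?mul0r ?mulr0 ?addr0//; right; lra.
(* The shortest route always leaves through the final vertex. *)
have qZ : turn e = 0.
  apply/eqP; rewrite eq_le q0 andbT leNgt; apply/negP => q0'; apply: ncut.
  by rewrite q0' lt_neqAle qL.
have C := C2D (C2_cst (d (j_end e) + lr e))
  (C2_comp (C2_affine (- lr e) 0) (aff ((lr e)^-1) 0)).
do 3!eexists; split; first exact: C.
- move=> t; rewrite /= [- lr e * _ + 0]addr0.
  have [t0|t0] := leP t 0; first by rewrite dti// E0'// mulr0 addr0; lra.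
  have [tl|tl] := leP (lr e) t; first by rewrite dtj// El// mulr1; lra.
  rewrite dto ?t0// xt tlE ?t0// dist_pt_ge_turn ?qZ//.
  by rewrite mulNr.
- by rewrite /= mulr0 !e10 ?mul0r ?mulr0 ?addr0//; left; lra.
- rewrite /= mulVf// !e10 ?mul0r ?mulr0 ?addr0//; right; lra.
Qed.

Lemma dtilde_ge0 x : 0 <= dtilde eta x0 x.
Proof. by case: x => [v|[e y]] /=; exact: dist_ge0 HG _ _. Qed.

Lemma xtilde_itv e t : 0 <= t <= lr e -> 0 <= xtilde eta x0 e t <= lr e.
Proof.
move=> /andP[t0 tl]; have l0 := lr_gt0 HG e.
rewrite /xtilde; case: ifPn => [/asboolP[q cq]|_].
  have -> : xget 0 (cutpt x0 e) = turn e.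
    have : cutpt x0 e (xget 0 (cutpt x0 e)) by apply: xgetPex; exists q.
    by rewrite [X in X _ -> _]cutptE => -[].
  have /andP[q0 ql] := turn_itv e.
  case: ifPn => [t2|]; last rewrite -ltNge => t2.
    have : 0 <= 2 * t / lr e <= 1.
      by apply/andP; split; [apply: divr_ge0|rewrite ler_pdivrMr//]; lra.
    move=> /(eta_range He)/andP[a b].
    by rewrite mulr_ge0//= (le_trans _ ql)// ler_piMr.
  have : 0 <= (2 * t - lr e) / lr e <= 1.
    by apply/andP; split; [apply: divr_ge0|rewrite ler_pdivrMr//]; lra.
  move=> /(eta_range He)/andP[a b].
  have lq0 : 0 <= lr e - turn e by rewrite subr_ge0.
  have := mulr_ge0 lq0 a; have := ler_piMr lq0 b.
  by move=> h1 h2; apply/andP; split; lra.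
have : 0 <= t / lr e <= 1.
  by apply/andP; split; [apply: divr_ge0|rewrite ler_pdivrMr//]; lra.
move=> /(eta_range He)/andP[a b].
by rewrite mulr_ge0 ?(ltW l0)//= ler_piMr// ltW.
Qed.

(** The modified distance at a point of e is the distance at some point of e, so
    that an edge meeting the support meets the ball of radius 2 rho. *)
Lemma edges_supp_finite (rho : R) : 0 < rho ->
  finite_set (edges_supp eta x0 rho).
Proof.
move=> r0; have r20 : 0 < 2 * rho by rewrite mulr_gt0.
have [_] := st_finite_balls HG r20; apply: sub_finite_set => e [t].
move=> /(cedgeP HG) te; rewrite /supp/= => dt.
have l0 := ltW (lr_gt0 HG e).
have [t0|t0] := leP t 0.
  exists 0; first by apply/(cedgeP HG); rewrite lexx.
  by move: dt; rewrite /ball_at/= !pt_le0.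
have [tl|tl] := leP (lr e) t.
  exists (lr e); first by apply/(cedgeP HG); rewrite l0 lexx.
  by move: dt; rewrite /ball_at/= !(pt_gel HG).
have tl' : 0 < t < lr e by rewrite t0 tl.
exists (xtilde eta x0 e t).
  by apply/(cedgeP HG); exact: xtilde_itv.
by move: dt; have [y -> <-] := pt_in HG tl'.
Qed.

End profile.

(** * Green's formula on an edge *)

Section green.
Context {R : realType}.
Notation mu := (@lebesgue_measure R).

Lemma continuous_bounded_segment (a b : R) (h : R -> R) :
  {within `[a, b], continuous h} ->
  [bounded h x | x in ([set` `[a, b]] : set R)].
Proof.
move=> ch; have /compact_bounded[M [_ mrt]] := continuous_compact ch (@segment_compact _ a b).
by exists M; split; rewrite ?num_real // => ? ? ? ?; exact: mrt.
Qed.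

(** The derivative of P V1 - v P1 is P V2 - v P2.  At the ends the terms in P1
    drop, so only those in V1 survive.  V2 is cut off to the open interval: it is
    uncontrolled at the ends. *)
Lemma green_segment (l : R) (v V1 V2 P P1 P2 : R -> R) : 0 < l ->
  {within `[0, l], continuous v} -> {within `[0, l], continuous V1} ->
  (forall x, 0 < x < l -> is_derive x 1 v (V1 x)) ->
  (forall x, 0 < x < l -> is_derive x 1 V1 (V2 x)) ->
  (forall x, 0 < x < l -> {for x, continuous V2}) ->
  mu.-integrable `[0, l] (EFin \o (V2 \_ `]0, l[)%R) ->
  C2 P P1 P2 -> P1 0 = 0 -> P1 l = 0 ->
  mu.-integrable `[0, l] (EFin \o (v \* P2)%R) /\
  (\int[mu]_(x in `[0%R, l]) (P x * (V2 \_ `]0, l[)%R x)%:E =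
   (P l * V1 l - P 0 * V1 0)%:E +
   \int[mu]_(x in `[0%R, l]) (v x * P2 x)%:E)%E.
Proof.
move=> l0 cv cV1 dv dV1 cV2 iV2 [dP dP1 cP2] P10 P1l.
have cP := is_derive_continuous dP; have cP1 := is_derive_continuous dP1.
have wP : {within `[0, l], continuous P} by apply: continuous_subspaceT => x; exact: cP.
have wP1 : {within `[0, l], continuous P1} by apply: continuous_subspaceT => x; exact: cP1.
have wP2 : {within `[0, l], continuous P2} by apply: continuous_subspaceT => x; exact: cP2.
have iB : mu.-integrable `[0, l] (EFin \o (v \* P2)%R).
  apply: continuous_compact_integrable; first exact: segment_compact.
  by move=> x; apply: cvgM; [exact: cv|exact: wP2].
have mI : measurable ([set` `[0, l]] : set (measurableTypeR R)).
  exact: measurable_itv.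
have iA : mu.-integrable `[0, l] (EFin \o (P \* (V2 \_ `]0, l[))%R).
  have mP : measurable_fun ([set` `[0, l]] : set (measurableTypeR R)) P.
    by apply: measurable_funTS; exact: continuous_measurable_fun.
  exact: (integrableMr mI mP (continuous_bounded_segment wP) iV2).
split=> //.
have V2E x : 0 < x < l -> (V2 \_ `]0, l[)%R x = V2 x.
  by move=> xl; rewrite patchE mem_set//= in_itv.
have cF : {within `[0, l], continuous ((P \* V1) \- (v \* P1))}.
  move=> x; apply: cvgB; first by apply: cvgM; [exact: wP|exact: cV1].
  by apply: cvgM; [exact: cv|exact: wP1].
have dF x : 0 < x < l -> is_derive x 1 ((P \* V1) \- (v \* P1))
    (((P \* (V2 \_ `]0, l[)%R) \- (v \* P2)) x).
  move=> xl; have d1 := is_deriveM (dP x) (dV1 _ xl).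
  have d2 := is_deriveM (dv _ xl) (dP1 x).
  apply: (is_derive_eq (is_deriveB d1 d2)).
  by rewrite /= V2E// /GRing.scale/=; ring.
have cf x : 0 < x < l -> {for x, continuous ((P \* (V2 \_ `]0, l[)%R) \- (v \* P2))}.
  move=> xl; have cvx : {for x, continuous v}.
    apply: differentiable_continuous; apply/derivable1_diffP.
    by have [] := dv _ xl.
  apply: cvgB; last by apply: cvgM; [exact: cvx|exact: cP2].
  apply: cvgM; first exact: cP.
  rewrite V2E//; apply: cvg_trans (cV2 _ xl); apply: near_eq_cvg; near=> y.
  rewrite V2E//; apply/andP; split; near: y; case/andP: xl => x0 xl.
    exact: lt_nbhsr.
  exact: lt_nbhsl.
have iAB : mu.-integrable `[0, l] (EFin \o ((P \* (V2 \_ `]0, l[)) \- (v \* P2))%R).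
  have := integrableB mI iA iB.
  by apply: eq_integrable.
have := FTC_interior l0 cF dF cf iAB.
under eq_integral do rewrite /= EFinB.
rewrite integralB//.
rewrite /= P10 P1l !mulr0 !subr0 => <-.
by rewrite subeK//; exact: integrable_fin_num.
Unshelve. all: by end_near. Qed.

End green.

Section bounded_integrable.
Context {R : realType}.
Notation mu := (@lebesgue_measure R).

Lemma Lfun_oo_integrable (l : R) (f : measurableTypeR R -> R) :
  f \in Lfun mu +oo%E -> mu.-integrable `[0, l] (EFin \o f).
Proof.
rewrite inE => /andP[/[1!inE]/= mf].
rewrite inE/= /finite_norm unlock /Lnorm.
have mI : measurable ([set` `[0, l]] : set (measurableTypeR R)).
  exact: measurable_itv.
have mu0 : (0 < mu [set: R])%E.
  rewrite (@lt_le_trans _ _ (mu ([set` `[0, 1]] : set (measurableTypeR R))))//.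
    by rewrite lebesgue_measure_itv/= lte_fin ltr01 oppr0 adde0 lte_fin.
  by apply: le_measure => //; rewrite inE; [exact: measurable_itv|exact: measurableT].
rewrite mu0 => /ess_supr_bounded[M fM].
apply/integrableP; split.
  by apply/measurable_EFinP; exact: measurable_funTS.
apply: (@le_lt_trans _ _ (\int[mu]_(x in `[0%R, l]) (`|M|)%:E)%E); last first.
  rewrite integral_cst//= lebesgue_measure_itv/=; case: ifPn => _.
    by rewrite -EFinD -EFinM ltry.
  by rewrite mule0 ltry.
apply: ae_ge0_le_integral => //.
- by apply/measurable_EFinP; apply: measurableT_comp => //; exact: measurable_funTS.
- apply: filterS fM => t/= ftM _.
  by rewrite lee_fin (le_trans ftM)// ler_norm.
Qed.

Lemma C2_derive1n (f f1 f2 : R -> R) : C2 f f1 f2 -> f^`(2)%classic = f2.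
Proof.
case=> df df1 _; have E (g g1 : R -> R) : (forall x : R, is_derive x 1 g (g1 x)) -> g^`()%classic = g1.
  by move=> dg; apply/funext => x; rewrite derive1E; have [_ ->] := dg x.
by rewrite /derive1n/= (E _ _ df) (E _ _ df1).
Qed.

End bounded_integrable.

Section edge_green.
Context {R : realType} {G : metric_graph R}.
Context {mu : vertex G -> R} {omega : edge G -> R} {x0 : vertex G}.
Hypothesis HG : standing mu omega x0.
Notation leb := (@lebesgue_measure R).

(** This is [green_segment] for u along e.  Relative derivatives of u on the closed
    edge provide the boundary values, and agree with ordinary derivatives
    inside. *)
Lemma edge_green (u g : gpoint G -> R) (e : edge G) (P1 P2 : R -> R) :
  domain_graph u -> C2 (restr g e) P1 P2 -> P1 0 = 0 -> P1 (lr e) = 0 ->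
  let U1 := derive_in (cedge e) (restr u e) in
  (\int[leb]_(x in `[0%R, lr e]) (restr u e x * P2 x)%:E)%E \is a fin_num /\
  (\int[leb]_(x in cedge e) (restr (g \* lapE u)%R e x)%:E =
   (restr g e (lr e) * U1 (lr e) - restr g e 0 * U1 0)%:E +
   \int[leb]_(x in `[0%R, lr e]) (restr u e x * P2 x)%:E)%E.
Proof.
move=> [cu du] CP P10 P1l U1; set l := lr e; set v := restr u e.
have l0 : 0 < l := lr_gt0 HG e.
have [dV cV2 [cv [dU1 [cU1 _]]] LV] := du e.
have ce := cedgeE HG e; have oe := oedgeE HG e.
have nb (x : R) : 0 < x < l -> \forall y \near x, 0 < y < l.
  case/andP=> x0' xl; near=> y; apply/andP; split; near: y.
    exact: lt_nbhsr.
  exact: lt_nbhsl.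
have dvU (x : R) : 0 < x < l -> is_derive x 1 v (U1 x).
  move=> xl; apply: derive_in_is_derive.
    apply: filterS (nb _ xl) => y /andP[y0 yl].
    by apply/(cedgeP HG); rewrite !ltW.
  by apply: dU1; apply/(cedgeP HG); case/andP: xl => ? ?; rewrite !ltW.
have U1E (x : R) : 0 < x < l -> v^`()%classic x = U1 x.
  by move=> /dvU[_ <-]; rewrite derive1E.
have oP (x : R) : 0 < x < l -> oedge e x by rewrite oe/= in_itv.
have wv : {within `[0, l], continuous v} by rewrite -ce; exact: cu.
have wU1 : {within `[0, l], continuous U1} by rewrite -ce.
have dUV (x : R) : 0 < x < l -> is_derive x 1 U1 (v^`(2)%classic x).
  move=> xl; apply: (near_eq_is_derive (f := v^`()%classic)).
    by apply: filterS (nb _ xl) => y /U1E.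
  have [_ d2] := dV x (oP _ xl); split; first exact: d2.
  by rewrite -derive1E.
have cV (x : R) : 0 < x < l -> {for x, continuous v^`(2)%classic}.
  move=> xl; move: cV2; rewrite continuous_open_subspace; last first.
    by rewrite oe; exact: interval_open.
  by apply; rewrite inE; exact: oP.
have iV : leb.-integrable `[0, l] (EFin \o (v^`(2)%classic \_ `]0, l[)%R).
  by rewrite -oe; exact: Lfun_oo_integrable.
have [gs1 gs2] := green_segment l0 wv wU1 dvU dUV cV iV CP P10 P1l.
split; first by apply: integrable_fin_num gs1; exact: measurable_itv.
rewrite -gs2 ce; apply: eq_integral => x _.
congr (_%:E); rewrite /restr /=; congr (_ * _).
rewrite patchE; case: ifPn => [/set_mem/=|].
  by rewrite in_itv/= => /(pt_in HG)[y -> <-].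
move=> /negP xn; have {}xn : ~ (0 < x < l) by move=> xl; apply: xn; rewrite inE/= in_itv.
have [x0'|x0'] := leP x 0; first by rewrite pt_le0.
have [xl|xl] := leP l x; first by rewrite (pt_gel HG).
by case: xn; rewrite x0' xl.
Unshelve. all: by end_near. Qed.

(** Clamping to [0, l_e] does not change the point of e, so a neighborhood in the
    line of a coordinate off the segment is mapped off the support, where g = 0;
    this covers the endpoints 0 and l_e too.  Hence g'' vanishes there. *)
Lemma segment_integral (eta : R -> R) (rho : R) (u g : gpoint G -> R) (e : edge G)
    (P1 P2 : R -> R) : C2 (restr g e) P1 P2 ->
  (forall x, ~ supp eta x0 rho x -> g x = 0) ->
  (\int[leb]_(x in `[0%R, lr e]) (restr u e x * P2 x)%:E =
   \int[leb]_(x in segment_supp eta x0 rho e)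
     (restr u e x * (restr g e)^`(2)%classic x)%:E)%E.
Proof.
move=> CP g0; rewrite (C2_derive1n CP).
have l0 := ltW (lr_gt0 HG e).
rewrite integral_mkcond [RHS]integral_mkcond; apply: eq_integral => x _.
rewrite !patchE.
set S := [set y | cedge e y /\ supp eta x0 rho (pt e y)].
have segE : segment_supp eta x0 rho e = closure S by [].
have sub : segment_supp eta x0 rho e `<=` `[0, lr e].
  have cI : closed ([set` `[0, lr e]] : set R) by exact: interval_closed.
  rewrite segE [X in _ `<=` X](iffLR (closure_id _) cI).
  by apply: closure_subset => y [] /(cedgeP HG); rewrite /= in_itv.
case: ifPn => xI; case: ifPn => xS //; last first.
  by case/negP: xI; rewrite inE; apply: sub; rewrite -inE.
have xl : 0 <= x <= lr e by move: xI; rewrite inE/= in_itv.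
suff -> : P2 x = 0 by rewrite mulr0.
have nS : ~ closure S x by move=> cS; case/negP: xS; rewrite inE.
have near0 : \forall y \near x, restr g e y = 0.
  have nc : nbhs (clamp (lr e) x) (~` closure S).
    rewrite clamp_id//; apply: open_nbhs_nbhs; split => //.
    exact: (closed_openC (@closed_closure _ S)).
  have : nbhs x (clamp (lr e) @^-1` (~` closure S)) by exact: (clamp_continuous nc).
  apply: filterS => y nSy.
  rewrite /restr -(pt_clamp HG); apply: g0 => sy; apply: nSy.
  apply: subset_closure; split=> //; apply/(cedgeP HG); exact: (clamp_itv _ l0).
have -> : P2 x = (restr g e)^`(2)%classic x by rewrite (C2_derive1n CP).
rewrite /derive1n/= derive1E.
have near0' : \forall y \near x, cst 0 y = (restr g e)^`()%classic y.
  apply: filterS (nbhs_interior near0) => y gy.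
  rewrite derive1E (@near_eq_derive _ _ _ _ (cst 0 : R -> R)) ?derive_cst//.
by rewrite -(near_eq_derive _ near0') derive_cst.
Unshelve. all: by end_near. Qed.

End edge_green.

(** * Finite sums over the graph *)

Section finite_sums.
Context {R : realType}.

Lemma csum_fin (T : choiceType) (A : set T) (f : T -> R) : finite_set A ->
  (forall i, ~ A i -> f i = 0) ->
  csum (fun i => (f i)%:E) = (\sum_(i \in A) f i)%:E.
Proof.
move=> finA f0.
have H (F : T -> R) : (forall i, 0 <= F i) -> (forall i, ~ A i -> F i = 0) ->
    (\esum_(i in [set: T]) (F i)%:E = (\sum_(i \in A) F i)%:E)%E.
  move=> F_ge0 F0; transitivity (\esum_(i in A) (F i)%:E)%E.
    rewrite [RHS]esum_mkcond; apply: eq_esum => i _.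
    by case: ifPn => // /negP nA; rewrite F0// => Ai; apply: nA; rewrite inE.
  rewrite esum_fset//; first by rewrite !fsbig_finite//= sumEFin.
  by move=> i _; rewrite lee_fin.
rewrite /csum.
have -> : ((fun i => (f i)%:E)^\+ = fun i => (Num.max (f i) 0)%:E)%E.
  by apply/funext => i; rewrite funeposE EFin_max.
have -> : ((fun i => (f i)%:E)^\- = fun i => (Num.max (- f i) 0)%:E)%E.
  by apply/funext => i; rewrite funenegE EFin_max.
rewrite !H.
- rewrite -EFinB !fsbig_finite//= -sumrB; congr (_%:E); apply: eq_bigr => i _.
  have [h|h] := leP 0 (f i).
    by rewrite max_r ?oppr_le0// subr0.
  by rewrite max_l ?oppr_ge0 ?(ltW h)// sub0r opprK.
- by move=> i; rewrite le_max lexx orbT.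
- by move=> i /f0 ->; rewrite oppr0 maxxx.
- by move=> i; rewrite le_max lexx orbT.
- by move=> i /f0 ->; rewrite maxxx.
Qed.

End finite_sums.

Section graph_sums.
Context {R : realType} {G : metric_graph R}.
Context {mu : vertex G -> R} {omega : edge G -> R} {x0 : vertex G}.
Hypothesis HG : standing mu omega x0.
Hypothesis mu_gt0 : forall v, 0 < mu v.
Variable p : gpoint G -> R.
Let Vs := [set v | p (vtx v) != 0].
Hypothesis finV : finite_set Vs.

Lemma adj_sym (v w : vertex G) : adj v w -> adj w v.
Proof. by case=> e [] ?; exists e; [right|left]. Qed.

Lemma finite_adj (v : vertex G) : finite_set [set w | adj v w].
Proof.
have finI := st_locally_finite HG v.
apply: (@sub_finite_set _ _ (i_end (m := G) @` [set e | incident e v] `|`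
                             j_end (m := G) @` [set e | incident e v])).
  move=> w [e [[iv jw]|[iw jv]]].
    by right; exists e => //; left.
  by left; exists e => //; right.
by rewrite finite_setU; split; exact: finite_image.
Qed.

Lemma weight_sym (v w : vertex G) : weight omega v w = weight omega w v.
Proof.
rewrite /weight; apply: eq_fsbigl; apply/seteqP.
by split=> e /= [?|?]; [right|left|right|left].
Qed.

Lemma weight_nadj (v w : vertex G) : ~ adj v w -> weight omega v w = 0.
Proof.
move=> nvw; rewrite /weight (_ : [set e | joins e v w] = set0) ?fsbig_set0//.
by apply/seteqP; split=> // e vw; apply: nvw; exists e.
Qed.

(** The diagonal terms weight(v, w) p(v) u(v) are common to both sides, and the
    others match after exchanging v and w. *)
Lemma lapV_symmetric (u : gpoint G -> R) :
  intV mu (p \* lapV mu omega u) =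
  intV mu (fun x => u x * lapV mu omega p x).
Proof.
(* Both families of terms live on the support of p and its neighbors. *)
set N := Vs `|` \bigcup_(v in Vs) [set w | adj v w].
have finN : finite_set N.
  by rewrite finite_setU; split=> //; apply: bigcup_finite => // v _; exact: finite_adj.
have pN v : ~ N v -> p (vtx v) = 0.
  move=> nNv; apply/eqP/negPn/negP => pv; apply: nNv; by left.
have pNadj v w : adj v w -> ~ N w -> p (vtx v) = 0.
  move=> vw nNw; apply/eqP/negPn/negP => pv; apply: nNw; right; by exists v.
have mu_lapV f g v : mu v * (f (vtx v) * lapV mu omega g (vtx v)) =
    f (vtx v) * \sum_(w \in [set w | adj v w])
      weight omega v w * (g (vtx w) - g (vtx v)).
  by rewrite /= mulrCA mulVKf// gt_eqF.
have toN f g v : (forall w, adj v w -> ~ N w ->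
      f (vtx v) * (weight omega v w * (g (vtx w) - g (vtx v))) = 0) ->
    mu v * (f (vtx v) * lapV mu omega g (vtx v)) =
    \sum_(w \in N) f (vtx v) * (weight omega v w * (g (vtx w) - g (vtx v))).
  move=> off; rewrite mu_lapV mulr_fsumr.
  transitivity (\sum_(w \in [set w | adj v w] `|` N)
      f (vtx v) * (weight omega v w * (g (vtx w) - g (vtx v)))).
    apply: fsbig_widen; first by move=> w; left.
    by move=> w [_ nvw]; rewrite /preimage/= weight_nadj// mul0r mulr0.
  apply/esym/fsbig_widen; first by move=> w; right.
  by move=> w [[vw|//] nNw]; exact: off.
have L1 v : mu v * (p (vtx v) * lapV mu omega u (vtx v)) =
    \sum_(w \in N) p (vtx v) * (weight omega v w * (u (vtx w) - u (vtx v))).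
  by apply: toN => w vw nNw; rewrite (pNadj _ _ vw nNw) mul0r.
have L2 v : mu v * (u (vtx v) * lapV mu omega p (vtx v)) =
    \sum_(w \in N) u (vtx v) * (weight omega v w * (p (vtx w) - p (vtx v))).
  by apply: toN => w vw nNw; rewrite (pNadj _ _ vw nNw) pN// subrr !mulr0.
have IL : intV mu (p \* lapV mu omega u)%R = (\sum_(v \in N) \sum_(w \in N)
    p (vtx v) * (weight omega v w * (u (vtx w) - u (vtx v))))%:E.
  rewrite /intV (csum_fin finN).
    by congr (_%:E); apply: eq_fsbigr => v _; rewrite /= -L1.
  by move=> v nNv; rewrite /= pN// mul0r mulr0.
have IR : intV mu (fun x => (u x * lapV mu omega p x)%R) =
    (\sum_(v \in N) \sum_(w \in N)
    u (vtx v) * (weight omega v w * (p (vtx w) - p (vtx v))))%:E.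
  rewrite /intV (csum_fin finN).
    by congr (_%:E); apply: eq_fsbigr => v _; exact: L2.
  move=> v nNv; rewrite L2 fsbig1// => w Nw; rewrite (pN v)// subr0.
  have [vw|nvw] := pselect (adj v w); last by rewrite weight_nadj// mul0r mulr0.
  by rewrite (pNadj w v (adj_sym vw) nNv) !mulr0.
rewrite IL IR !fsbig_finite//=; congr (_%:E).
transitivity (\sum_(v <- finmap.enum_fset (fset_set N)) \sum_(w <- finmap.enum_fset (fset_set N))
    p (vtx v) * (weight omega v w * u (vtx w)) -
    \sum_(v <- finmap.enum_fset (fset_set N)) \sum_(w <- finmap.enum_fset (fset_set N))
    u (vtx v) * (weight omega v w * p (vtx v))).
  rewrite -sumrB; apply: eq_bigr => v _; rewrite fsbig_finite// -sumrB.
  by apply: eq_bigr => w _; ring.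
rewrite exchange_big/= -sumrB; apply: eq_bigr => v _; rewrite fsbig_finite// -sumrB.
by apply: eq_bigr => w _; rewrite (weight_sym w v); ring.
Qed.

(** Each edge contributes p(v) times a normal derivative at each of its two ends,
    which are distinct; collecting by vertices instead gives p(v) K(u)(v), as every
    edge incident to the support of p is counted. *)
Lemma kirchhoff_boundary (u : gpoint G -> R) (Es : set (edge G)) :
  (forall v, kirchhoff u v = 0) -> finite_set Es ->
  (forall e v, incident e v -> Vs v -> Es e) ->
  \sum_(e \in Es) (p (vtx (j_end e)) * derive_in (cedge e) (restr u e) (lr e) -
                   p (vtx (i_end e)) * derive_in (cedge e) (restr u e) 0) = 0.
Proof.
move=> HK finE VE.
pose F e v := if `[< incident e v >] then p (vtx v) * normal_deriv u e v else 0.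
have term e : p (vtx (j_end e)) * derive_in (cedge e) (restr u e) (lr e) -
              p (vtx (i_end e)) * derive_in (cedge e) (restr u e) 0 =
              \sum_(v \in Vs) F e v.
  have ij := st_noloop HG (e := e).
  have -> : \sum_(v \in Vs) F e v = \sum_(v \in [set i_end e] `|` [set j_end e]) F e v.
    transitivity (\sum_(v \in Vs `|` ([set i_end e] `|` [set j_end e])) F e v).
      apply: fsbig_widen; first by move=> v; left.
      move=> v [_ nVs]; rewrite /preimage/= /F; case: ifPn => // _.
      have -> : p (vtx v) = 0 by apply/eqP/negPn/negP.
      by rewrite mul0r.
    apply/esym/fsbig_widen; first by move=> v; right.
    move=> v [_ nij]; rewrite /preimage/= /F asboolF// => -[iv|jv]; apply: nij.
      by left; rewrite /= iv.
    by right; rewrite /= jv.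
  rewrite fsbigU0 ?fsbig_set1//=; first last.
    by move=> v [/= -> /ij].
  rewrite /F !asboolT; [|by right|by left].
  rewrite /normal_deriv eqxx ifF; last by apply/eqP => /esym.
  by rewrite mulrN addrC.
under eq_fsbigr do rewrite term.
rewrite exchange_fsbig//; apply: fsbig1 => v Vv.
transitivity (p (vtx v) * kirchhoff u v); last by rewrite HK mulr0.
rewrite /kirchhoff mulr_fsumr.
transitivity (\sum_(e \in [set e | incident e v]) F e v); last first.
  by apply: eq_fsbigr => e; rewrite inE /F /= => ev; rewrite asboolT.
apply/esym/fsbig_widen; first by move=> e ev; exact: VE ev Vv.
by move=> e [_ /= nev]; rewrite /preimage/= /F asboolF.
Qed.

End graph_sums.

(** * The test function and the identity *)

Section testfun_power.
Context {R : realType} {G : metric_graph R}.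
Context {mu : vertex G -> R} {omega : edge G -> R} {x0 : vertex G}.
Hypothesis HG : standing mu omega x0.
Context {eta phi : R -> R} {s rho : R}.
Hypotheses (Heta : is_eta eta) (Hphi : is_phi phi).
Hypotheses (s2 : 2 < s) (rho_gt0 : 0 < rho).
Let phis : gpoint G -> R := fun x => (testfun eta phi x0 rho x) `^ s.

Lemma testfun_off_supp x : ~ supp eta x0 rho x -> phis x = 0.
Proof.
move=> /negP; rewrite -leNgt => h.
rewrite /phis /testfun (phi_0 Hphi); last by rewrite ler_pdivlMr.
by rewrite powR0// gt_eqF// (lt_trans _ s2).
Qed.

Lemma testfun_edge_C2 e : exists P1 P2,
  [/\ C2 (restr phis e) P1 P2, P1 0 = 0 & P1 (lr e) = 0].
Proof.
have [th [th1 [th2 [Cth thE]]]] := C2_phi_power Hphi s2.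
have [w [w1 [w2 [Cw wE w10 w1l]]]] := dtilde_profile HG Heta e.
have C := C2_comp (C2_comp Cth (C2_affine rho^-1 0)) Cw.
have -> : restr phis e = (th \o (fun x => rho^-1 * x + 0)) \o w.
  apply/funext => t; rewrite /= /restr /phis /testfun wE addr0 mulrC thE//.
  by rewrite mulr_ge0 ?invr_ge0 ?(ltW rho_gt0)// -wE; exact: (dtilde_ge0 HG).
do 2!eexists; split; first exact: C.
  by rewrite /= w10 mulr0.
by rewrite /= w1l mulr0.
Qed.

Lemma finite_testfun_vertices : finite_set [set v | phis (vtx v) != 0].
Proof.
have r20 : 0 < 2 * rho by rewrite mulr_gt0.
have [+ _] := st_finite_balls HG r20; apply: sub_finite_set => v /= pv.
by apply/not_notP => nv; move/eqP: pv; apply; exact: testfun_off_supp.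
Qed.

End testfun_power.

Theorem lemma4p6 (R : realType) (G : metric_graph R)
    (mu : vertex G -> R) (omega : edge G -> R) (x0 : vertex G)
    (mu_gt0 : forall v, 0 < mu v) (omega_gt0 : forall e, 0 < omega e)
    (HG : standing mu omega x0)
    (eta phi : R -> R) (Heta : is_eta eta) (Hphi : is_phi phi)
    (sigma s rho : R) (sigma_gt1 : 1 < sigma)
    (s_gt : Num.max 2 (sigma / (sigma - 1)) < s)
    (rho_ge : Num.max (2 * jmax G) 1 <= rho)
    (u : gpoint G -> R) (Hu : domain_graph u)
    (HK : forall v, kirchhoff u v = 0) :
  let phis : gpoint G -> R := fun x => (testfun eta phi x0 rho x) `^ s in
  (lap_functional mu omega u phis =
   intV mu (fun x => (u x * lapV mu omega phis x)%R) +
   \sum_(e \in edges_supp eta x0 rho)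
     \int[lebesgue_measure]_(x in segment_supp eta x0 rho e)
       (restr u e x * (restr phis e)^`(2)%classic x)%:E)%E.
Proof.
move=> phis.
have s2 : 2 < s by move: s_gt; rewrite gt_max => /andP[].
have rho0 : 0 < rho by move: rho_ge; rewrite ge_max => /andP[_]; exact: lt_le_trans.
have off : forall x, ~ supp eta x0 rho x -> phis x = 0.
  exact: (testfun_off_supp Hphi s2 rho0).
have finV : finite_set [set v | phis (vtx v) != 0].
  exact: (finite_testfun_vertices HG Hphi s2 rho0).
rewrite /lap_functional -(lapV_symmetric HG mu_gt0 finV u); congr (_ + _)%E.
set Es := edges_supp eta x0 rho.
have finE : finite_set Es := edges_supp_finite HG Heta rho0.
set U1 := fun e => derive_in (cedge e) (restr u e).
set seg := fun e => (\int[lebesgue_measure]_(x in segment_supp eta x0 rho e)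
       (restr u e x * (restr phis e)^`(2)%classic x)%:E)%E.
(* The boundary term left on e by the integration by parts. *)
pose B e := phis (vtx (j_end e)) * U1 e (lr e) - phis (vtx (i_end e)) * U1 e 0.
have edgeE e : seg e = (fine (seg e))%:E /\
    (\int[lebesgue_measure]_(x in cedge e) (restr (phis \* lapE u)%R e x)%:E =
    (B e + fine (seg e))%:E)%E.
  have [P1 [P2 [CP P10 P1l]]] := testfun_edge_C2 HG Heta Hphi s2 rho0 e.
  have [iP intE] := edge_green HG Hu CP P10 P1l.
  have segE := segment_integral HG u CP off.
  have fin : seg e \is a fin_num.
    by rewrite /seg -segE.
  split; first by rewrite fineK.
  rewrite EFinD fineK// intE segE; congr ((_ - _)%:E + _)%E.
    by rewrite /restr (pt_gel HG).
  by rewrite /restr pt_le0.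
have offE e : ~ Es e -> B e + fine (seg e) = 0.
  move=> nE; have l0 := ltW (lr_gt0 HG e).
  have nS t : 0 <= t <= lr e -> ~ supp eta x0 rho (pt e t).
    by move=> /(cedgeP HG) te st; apply: nE; exists t.
  have -> : seg e = 0%E.
    rewrite /seg (_ : segment_supp _ _ _ _ = set0) ?integral_set0//.
    rewrite /segment_supp -[RHS]closure0; congr closure.
    by apply/seteqP; split=> // t [/(cedgeP HG)/nS].
  have := nS 0; rewrite lexx pt_le0// => /(_ l0) /off pi.
  have := nS (lr e); rewrite lexx l0 (pt_gel HG)// => /(_ isT) /off pj.
  by rewrite /B pi pj !mul0r subrr addr0.
have VE e v : incident e v -> [set v | phis (vtx v) != 0] v -> Es e.
  move=> ev /= pv; have sv : supp eta x0 rho (vtx v).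
    by apply/not_notP => /off; exact/eqP.
  have l0 := ltW (lr_gt0 HG e).
  case: ev => ev; [exists 0|exists (lr e)].
  - by apply/(cedgeP HG); rewrite lexx.
  - by rewrite pt_le0// ev.
  - by apply/(cedgeP HG); rewrite l0 lexx.
  - by rewrite (pt_gel HG)// ev.
have B0 := kirchhoff_boundary HG finV HK finE VE.
rewrite /intE.
under [X in csum X]eq_fun do rewrite (edgeE _).2.
rewrite (csum_fin finE offE) fsbig_split//= -/B.
rewrite [X in X + _]B0 add0r -fsumEFin//.
by apply: eq_fsbigr => e _; rewrite -(edgeE e).1.
Qed.
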